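(* Suppose that $\mathbb{F}$ is an algebraically closed field of characteristic $0$. Then any simple finite-dimensional transposed Poisson superalgebra $(\mathcal{P}=\mathcal{P}_0\oplus\mathcal{P}_1,\circ,\{\cdot,\cdot\})$ over $\mathbb{F}$ is trivial, i.e. at least one of its two multiplications $\circ$ and $\{\cdot,\cdot\}$ is identically zero.
   Context: A transposed Poisson superalgebra is a $\mathbb{Z}_2$-graded vector space $\mathcal{P}=\mathcal{P}_0\oplus\mathcal{P}_1$ with two grading-compatible multiplications: an associative supercommutative multiplication $\circ$ (not necessarily unital) and a Lie superalgebra bracket $\{\cdot,\cdot\}$ (that is, $\{x,y\}=-(-1)^{|x||y|}\{y,x\}$ and $(-1)^{|x||z|}\{\{x,y\},z\}+(-1)^{|y||x|}\{\{y,z\},x\}+(-1)^{|z||y|}\{\{z,x\},y\}=0$) such that $2x\circ\{y,z\}=\{x\circ y,z\}+(-1)^{|x||y|}\{y,x\circ z\}$ for all homogeneous $x,y,z$, where $|x|$ is the parity of $x$. It is simple if it contains no proper nonzero $\mathbb{Z}_2$-graded subspace $\mathcal{I}$ with $\mathcal{I}\circ\mathcal{P}\subset\mathcal{I}$ and $\{\mathcal{I},\mathcal{P}\}\subset\mathcal{I}$. *)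

(* Defs.v *)
From HB Require Import structures.
From mathcomp Require Import all_boot all_order all_algebra.
Set Implicit Arguments.
Unset Strict Implicit.
Unset Printing Implicit Defensive.
Import GRing.Theory.
Local Open Scope ring_scope.

(* Parities are booleans: [false] is the even part, [true] the odd part.
   Parity addition is [(+)], and [ssign a b] is (-1)^(ab).  Homogeneous elements
   of parity [a] are the members of [V_ a]; 0 has both parities, so the graded
   identities below quantify over a parity together with an element. *)
Definition ssign (F : nzRingType) (a b : bool) : F := (-1) ^+ (a && b).

Section Superalgebras.
Variables (F : fieldType) (V : vectType F) (V_ : bool -> {vspace V}).
Implicit Types (mul br op : {bilinear V -> V -> V}) (I : {vspace V}).

Definition is_Z2grading : Prop :=
  directv (V_ false + V_ true)%VS /\ (V_ false + V_ true = fullv)%VS.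

Definition grading_compatible op : Prop :=
  forall (a b : bool) x y, x \in V_ a -> y \in V_ b -> op x y \in V_ (a (+) b).

Definition supercommutative op : Prop :=
  forall (a b : bool) x y, x \in V_ a -> y \in V_ b ->
    op x y = ssign F a b *: op y x.

Definition superanticommutative op : Prop :=
  forall (a b : bool) x y, x \in V_ a -> y \in V_ b ->
    op x y = - (ssign F a b *: op y x).

Definition super_Jacobi br : Prop :=
  forall (a b c : bool) x y z, x \in V_ a -> y \in V_ b -> z \in V_ c ->
    ssign F a c *: br (br x y) z + ssign F b a *: br (br y z) x
      + ssign F c b *: br (br z x) y = 0.

Definition transposed_Leibniz mul br : Prop :=
  forall (a b c : bool) x y z, x \in V_ a -> y \in V_ b -> z \in V_ c ->
    2 *: mul x (br y z) = br (mul x y) z + ssign F a b *: br y (mul x z).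

Record transposed_Poisson_superalgebra mul br : Prop :=
  TransposedPoissonSuperalgebra {
    tps_grading : is_Z2grading;
    tps_mul_graded : grading_compatible mul;
    tps_mulA : associative mul;
    tps_mulC : supercommutative mul;
    tps_br_graded : grading_compatible br;
    tps_br_anti : superanticommutative br;
    tps_br_Jacobi : super_Jacobi br;
    tps_Leibniz : transposed_Leibniz mul br
  }.

Definition graded_subspace I : Prop :=
  (I = (I :&: V_ false) + (I :&: V_ true))%VS.

Definition absorbs op I : Prop := forall x y, x \in I -> op x y \in I.

Definition simple_superalgebra mul br : Prop :=
  forall I, graded_subspace I -> absorbs mul I -> absorbs br I ->
    I = 0%VS \/ I = fullv.

End Superalgebras.

(* Main.v *)
Require Import Defs.
From Stdlib Require Import Classical.
From HB Require Import structures.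
From mathcomp Require Import all_boot all_order all_algebra.
From mathcomp Require Import ring.
Set Implicit Arguments.
Unset Strict Implicit.
Unset Printing Implicit Defensive.
Import GRing.Theory.
Local Open Scope ring_scope.

(** Write L_a for the multiplication by a and ad_y for the bracket with y.
    The compatibility law says that L_a is a half superderivation of the
    bracket: 2 L_a {x, y} = {L_a x, y} +- {x, L_a y}.  The supercommutator of a
    half superderivation with the derivation ad_y is again one, so the orbit of
    the L_a under iterated supercommutation with the ad_y ([ad_orbit]) consists
    of half superderivations.

    The heart of the proof is that any two operators of this orbit supercommute
    ([ad_orbit_commuting_pair]).  For a half superderivation T, the vector
    [ad_y, T] x is supersymmetric in x and y.  Call (T, U) a commuting pair if U
    supercommutes with T and with every [ad_x, T].  The pair (L_a, L_b) is one
    because the product L_a L_b is itself a multiplication, hence a half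
    superderivation.  For a commuting pair, the forms [ad_x, T] [ad_y, U] w and
    [ad_x, U] [ad_y, T] w turn out to be supersymmetric in all of x, y, w and to
    agree up to sign ([ad_comm_supercomm]); this says precisely that
    ([ad_x, T], U) is a commuting pair again, so the property spreads over the
    whole orbit.

    Simplicity, finite dimension and characteristic 0 now give the rest.
    Generalised eigenspaces of an even T of the orbit are graded ideals, so
    T - c is either injective or nilpotent ([ad_orbit_fitting]).  Hence every
    commutator u = [ad_y, T] is nilpotent ([ad_comm_locally_nilpotent]):
    - if u is odd, it supercommutes with itself, so u^2 = 0;
    - if y and T are odd, then u y = 0 by supersymmetry, so u is not injective;
    - if y and T are even, some s = T - c is nilpotent and commutes with
      u = [ad_y, s]; from s^(n+1) = 0 follows (n+1) s^n u = 0, so an injective u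
      would force s^n = 0, and finally 1 = 0.
    These supercommuting nilpotent operators have a common kernel vector; their
    common kernel is a graded ideal, so they all vanish ([ad_comm_eq0]).

    Thus each L_a supercommutes with every ad_y, and its eigenspaces are ideals:
    L_a is a scalar for a even and 0 for a odd.  If some L_a is a scalar c that
    is not 0, then c x = a x = +-x a is a multiple of a for every even x, and is
    0 for x odd; so the algebra is the line spanned by the even element a, and
    {a, a} = 0 by antisymmetry. *)

(** * Linear algebra *)

Section LinearAlgebra.
Variables (F : fieldType) (V : vectType F).
Implicit Types (S : V -> Prop) (T U : 'End(V)).

Definition linear_pred S := S 0 /\ forall c u v, S u -> S v -> S (c *: u + v).

(** This lets ideals be given by arbitrary propositions, such as quantifications
    over a whole family of operators. *)
Lemma vspace_of_pred S : linear_pred S ->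
  exists W : {vspace V}, forall v, v \in W <-> S v.
Proof.
move=> [S0 Slin].
suff H n (W : {vspace V}) : (\dim {:V} - \dim W <= n)%N ->
    (forall v, v \in W -> S v) ->
    exists W' : {vspace V}, forall v, v \in W' <-> S v.
  apply: (H _ 0%VS (leqnn _)) => v; rewrite memv0 => /eqP ->; exact: S0.
elim: n W => [|n IH] W leW WS.
  exists W => v; split=> [|_]; first exact: WS.
  have: (W == fullv)%VS by rewrite eqEdim subvf -subn_eq0 -leqn0.
  by move=> /eqP ->; apply: memvf.
have [[v Sv Wv]|noW] := classic (exists2 v, S v & v \notin W); last first.
  exists W => v; split=> [|Sv]; first exact: WS.
  by apply/negPn/negP => Wv; apply: noW; exists v.
apply: (IH (W + <[v]>)%VS) => [|w /memv_addP[w0 Ww0 [_ /vlineP[c ->] ->]]].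
  have ltW : (\dim W < \dim (W + <[v]>))%N.
    rewrite (ltn_leqif (dimv_leqif_sup (addvSl _ _))).
    apply: contra Wv => /subvP; apply; exact/(subvP (addvSr _ _))/memv_line.
  rewrite -ltnS (leq_trans _ leW) // ltn_sub2l //.
  by rewrite (leq_trans ltW) ?dimvS ?subvf.
by rewrite addrC; apply: Slin => //; apply: WS.
Qed.

(** The pointwise form is what ideal arguments produce; in finite dimension it
    is equivalent to nilpotency. *)
Definition locally_nilpotent T := forall z, exists n, iter n T z = 0.

Lemma iter_linear n T c u v :
  iter n T (c *: u + v) = c *: iter n T u + iter n T v.
Proof. by elim: n => //= n ->; rewrite linearP. Qed.

Lemma iter0 n T : iter n T 0 = 0.
Proof. by elim: n => //= n ->; rewrite linear0. Qed.

Lemma iter_eq0_leq m n T z : (m <= n)%N -> iter m T z = 0 -> iter n T z = 0.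
Proof. by move=> /subnK <- Tz; rewrite iterD Tz iter0. Qed.

Lemma locally_nilpotent_linear_pred T :
  linear_pred (fun z => exists n, iter n T z = 0).
Proof.
split=> [|c u v [m um] [n vn]]; first by exists 0%N.
exists (maxn m n); rewrite iter_linear.
rewrite (iter_eq0_leq (leq_maxl m n) um) (iter_eq0_leq (leq_maxr m n) vn).
by rewrite scaler0 addr0.
Qed.

Lemma nilpotent_of_locally_nilpotent T :
  locally_nilpotent T -> exists n, forall z, iter n T z = 0.
Proof.
move=> nT; have [f fP] :=
  fin_all_exists (fun i : 'I_(\dim {:V}) => nT (vbasis fullv)`_i).
have [n fn] : exists n, forall i, (f i <= n)%N.
  by exists (\max_i f i) => i; apply: leq_bigmax.
exists n => z; rewrite (coord_vbasis (memvf z)).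
elim/big_rec: _ => [|i w _ w0]; first exact: iter0.
by rewrite iter_linear w0 (iter_eq0_leq (fn i) (fP i)) scaler0 addr0.
Qed.

Lemma locally_nilpotent_ker T v : locally_nilpotent T -> v != 0 ->
  exists n, iter n T v != 0 /\ T (iter n T v) = 0.
Proof.
move=> /(_ v)[n]; elim: n => [/= ->|n IH Tv]; first by rewrite eqxx.
by have [/IH//|nz _] := eqVneq (iter n T v) 0; exists n.
Qed.

(** Commuting up to scalars is enough: the kernel of one operator is then stable
    under the others, so one may shrink a stable subspace until every operator
    vanishes on it. *)
Lemma common_kernel (Us : 'End(V) -> Prop) (W : {vspace V}) :
  (forall T, Us T -> locally_nilpotent T) ->
  (forall T U, Us T -> Us U -> exists c, forall z, T (U z) = c *: U (T z)) ->
  W != 0%VS -> (forall T v, Us T -> v \in W -> T v \in W) ->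
  exists2 v, v != 0 & forall T, Us T -> T v = 0.
Proof.
move=> nilU comU; elim: {W}_.+1 {-2}W (ltnSn (\dim W)) => // n IH W ltW W0 UW.
have [[T [w [UT Ww Tw]]]|noT] :=
  classic (exists T w, [/\ Us T, w \in W & T w != 0]); last first.
  exists (vpick W) => [|T UT]; first by rewrite vpick0.
  apply/eqP/negPn/negP=> nz; apply: noT; exists T, (vpick W).
  by split=> //; apply: memv_pick.
apply: (IH (W :&: lker T)%VS).
- rewrite -ltnS (leq_trans _ ltW) // ltnS.
  rewrite (ltn_leqif (dimv_leqif_sup (capvSl _ _))).
  apply: contra Tw => /subvP/(_ w Ww).
  by rewrite memv_cap memv_ker => /andP[].
- have pW0 : vpick W != 0 by rewrite vpick0.
  have [m [nz Tm]] := locally_nilpotent_ker (nilU T UT) pW0.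
  apply: contraNneq nz => K0.
  rewrite -memv0 -K0 memv_cap memv_ker Tm eqxx andbT.
  by elim: m {Tm} => [|m IHm] /=; [apply: memv_pick | apply: UW].
- move=> U v UU; rewrite !memv_cap !memv_ker => /andP[Wv /eqP Tv].
  by have [c ->] := comU T U UT UU; rewrite Tv linear0 scaler0 eqxx UW.
Qed.

End LinearAlgebra.

Section Eigenvector.
Import VectorInternalTheory.

(** The vector [w] only serves to exclude the zero space. *)
Lemma exists_eigenvector (F : closedFieldType) (V : vectType F) (T : 'End(V))
  (w : V) : w != 0 -> exists c, exists2 v, v != 0 & T v = c *: v.
Proof.
move=> w0; pose A := lin1_mx (v2r \o T \o r2v).
have [c] : exists c, root (char_poly A) c.
  apply/closed_rootP; rewrite size_char_poly eqSS.
  apply: contraNneq w0 => d0; apply/eqP/v2r_inj/rowP=> -[i ilt].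
  by exfalso; move: ilt; rewrite d0.
rewrite -eigenvalue_root_char => /eigenvalueP[u Au u0].
exists c, (r2v u); first by rewrite (can2_eq r2vK v2rK) linear0.
apply: v2r_inj; rewrite linearZ /= r2vK -Au.
by rewrite mul_rV_lin1.
Qed.

End Eigenvector.

(** * Half superderivations of the bracket *)

Section Operators.
Variables (F : fieldType) (P : vectType F) (P_ : bool -> {vspace P}).
Variables (mul br : {bilinear P -> P -> P}).
Implicit Types (p q r s : bool) (T U : 'End(P)).
Local Notation eps := (ssign F).

(** Derive a vector identity as a multiple of a known one, the remaining goal
    being an identity between linear combinations. *)
Lemma lincomb (c : F) (l r u v : P) : l = r -> u - v = c *: (l - r) -> u = v.
Proof. by move=> ->; rewrite subrr scaler0 => /subr0_eq. Qed.
Arguments lincomb c {l r u v}.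

Variable two_neq0 : 2 != 0 :> F.

Lemma lincomb2 (c : F) (l r u v : P) :
  l = r -> 2 *: (u - v) = c *: (l - r) -> u = v.
Proof.
move=> ->; rewrite subrr scaler0 => /eqP.
by rewrite scaler_eq0 (negbTE two_neq0) => /eqP /subr0_eq.
Qed.
Arguments lincomb2 c {l r u v}.

Definition homogeneous p T := forall q x, x \in P_ q -> T x \in P_ (p (+) q).

(** The law 2 T {x, y} = {T x, y} +- {x, T y}, solved for {T x, y}: oriented
    this way it rewrites every bracket into words in T and the ad_x. *)
Definition half_derivation p T := forall q x y, x \in P_ q ->
  br (T x) y = 2 *: T (br x y) - eps p q *: br x (T y).

(** For a half superderivation T this is, up to sign, the supercommutator of
    ad_y with T (see [ad_comm_half]).  This form is chosen because T and y occur
    in it in the same order as in the notation, which saves signs. *)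
Definition ad_comm T y : 'End(P) := (T \o linfun (br y) - linfun (br (T y)))%VF.

Lemma ad_commE T y x : ad_comm T y x = T (br y x) - br (T y) x.
Proof. by rewrite add_lfunE opp_lfunE comp_lfunE !lfunE. Qed.

Hypothesis tpP : transposed_Poisson_superalgebra P_ mul br.

Lemma homogeneous_decomp x : exists2 x0, x0 \in P_ false &
  exists2 x1, x1 \in P_ true & x = x0 + x1.
Proof.
have [_ PE] := tps_grading tpP.
by apply/memv_addP; rewrite PE memvf.
Qed.

Lemma homogeneous_ext T U :
  (forall q x, x \in P_ q -> T x = U x) -> forall x, T x = U x.
Proof.
move=> TU x; have [x0 Px0 [x1 Px1 ->]] := homogeneous_decomp x.
by rewrite !linearD /= (TU _ _ Px0) (TU _ _ Px1).
Qed.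

(* Sign identities are checked for each choice of parities; the remaining linear
   identity between vectors is checked on coordinates, where it is a ring
   identity. *)
Ltac signs := rewrite /ssign /= ?expr0 ?expr1.
Let crd i : P -> F := coord (vbasis fullv) i.
Let crdD i u v : crd i (u + v) = crd i u + crd i v. Proof. exact: linearD. Qed.
Let crdN i u : crd i (- u) = - crd i u. Proof. exact: linearN. Qed.
Let crdZ i c u : crd i (c *: u) = c * crd i u. Proof. exact: linearZ. Qed.
Let crd0 i : crd i 0 = 0. Proof. exact: linear0. Qed.
Let crdE := (crdD, crdN, crdZ, crd0).

Lemma crd_ext (u v : P) : (forall i, crd i u = crd i v) -> u = v.
Proof.
move=> uv; rewrite (coord_vbasis (memvf u)) (coord_vbasis (memvf v)).
by apply: eq_bigr => i _; rewrite [coord _ _ _]uv.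
Qed.

Let brDr x u v : br x (u + v) = br x u + br x v. Proof. exact: linearD. Qed.
Let brNr x u : br x (- u) = - br x u. Proof. exact: linearN. Qed.
Let brZr x c u : br x (c *: u) = c *: br x u. Proof. exact: linearZ_LR. Qed.
Let brDl x u v : br (u + v) x = br u x + br v x. Proof. exact: linearDl. Qed.
Let brNl x u : br (- u) x = - br u x. Proof. exact: linearNl. Qed.
Let brZl x c u : br (c *: u) x = c *: br u x. Proof. exact: linearZl_LR. Qed.
Let brE := (brDr, brNr, brZr, brDl, brNl, brZl).

Let endD T u v : T (u + v) = T u + T v. Proof. exact: linearD. Qed.
Let endN T u : T (- u) = - T u. Proof. exact: linearN. Qed.
Let endZ T c u : T (c *: u) = c *: T u. Proof. exact: linearZ. Qed.
Let endE := (endD, endN, endZ).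

Let mulD a u v : mul a (u + v) = mul a u + mul a v. Proof. exact: linearD. Qed.
Let mulN a u : mul a (- u) = - mul a u. Proof. exact: linearN. Qed.
Let mulZ a c u : mul a (c *: u) = c *: mul a u. Proof. exact: linearZ_LR. Qed.
Let mulE := (mulD, mulN, mulZ).

Ltac vring := rewrite ?(brE, endE, mulE); apply: crd_ext; intros ?;
  rewrite ?crdE; ring.

Lemma br_Jacobi q r x y z : x \in P_ q -> y \in P_ r ->
  br (br x y) z = br x (br y z) - eps q r *: br y (br x z).
Proof.
move=> Px Py.
have E : linfun (br (br x y)) =1 (linfun (br x) \o linfun (br y)
    - eps q r *: (linfun (br y) \o linfun (br x)))%VF.
  apply: homogeneous_ext => s {}z Pz.
  rewrite !(add_lfunE, opp_lfunE, scale_lfunE, comp_lfunE, lfunE) /=.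
  have := tps_br_Jacobi tpP Px Py Pz.
  rewrite (tps_br_anti tpP (tps_br_graded tpP Py Pz) Px).
  rewrite (tps_br_anti tpP Pz Px) linearNl linearZl_LR /=.
  rewrite (tps_br_anti tpP (tps_br_graded tpP Px Pz) Py).
  move=> J; apply: (lincomb (eps q s) J).
  by case: q r s {Px Py Pz J} => [] [] []; signs; vring.
have := E z.
by rewrite !(add_lfunE, opp_lfunE, scale_lfunE, comp_lfunE, lfunE).
Qed.

Lemma ad_comm_half p T q y x : half_derivation p T -> y \in P_ q ->
  ad_comm T y x = eps p q *: br y (T x) - T (br y x).
Proof. by move=> hT Py; rewrite ad_commE (hT q) //; vring. Qed.

(** Solving the law of T for {x, T y} instead of {T x, y} exchanges the roles of
    x and y. *)
Lemma ad_comm_sym p T q r x y :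
  homogeneous p T -> half_derivation p T -> x \in P_ q -> y \in P_ r ->
  ad_comm T y x = eps q r *: ad_comm T x y.
Proof.
move=> gT hT Px Py; rewrite ad_commE (ad_comm_half _ hT Px).
rewrite (tps_br_anti tpP (gT _ _ Py) Px) (tps_br_anti tpP Py Px).
by case: p q r {gT hT Px Py} => [] [] []; signs; vring.
Qed.

Lemma homogeneous_ad_comm p T q y :
  homogeneous p T -> y \in P_ q -> homogeneous (p (+) q) (ad_comm T y).
Proof.
move=> hT Py r x Px; rewrite ad_commE memvB //.
  by rewrite -addbA; apply: hT; apply: (tps_br_graded tpP).
by apply: (tps_br_graded tpP) => //; apply: hT.
Qed.

(** Superderivations act on half superderivations by supercommutation, since
    the defining law is invariant under every superderivation of the bracket. *)
Lemma half_derivation_ad_comm p T q y :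
  homogeneous p T -> half_derivation p T -> y \in P_ q ->
  half_derivation (p (+) q) (ad_comm T y).
Proof.
move=> gT hT Py r x z Px.
rewrite !(ad_comm_half _ hT Py) linearDl linearNl linearZl_LR /=.
rewrite (br_Jacobi _ Py (gT _ _ Px)).
rewrite !(hT _ _ _ Px) (hT _ _ _ (tps_br_graded tpP Py Px)).
rewrite !(br_Jacobi _ Py Px).
by case: p q r {gT hT Py Px} => [] [] []; signs; vring.
Qed.

Lemma br_mul p q a x y : a \in P_ p -> x \in P_ q ->
  br (mul a x) y = 2 *: mul a (br x y) - eps p q *: br x (mul a y).
Proof.
move=> Pa Px.
have E : linfun (br (mul a x)) =1 (2 *: (linfun (mul a) \o linfun (br x))
    - eps p q *: (linfun (br x) \o linfun (mul a)))%VF.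
  apply: homogeneous_ext => s {}y Py.
  rewrite !(add_lfunE, opp_lfunE, scale_lfunE, comp_lfunE, lfunE) /=.
  by rewrite (tps_Leibniz tpP Pa Px Py); vring.
have := E y.
by rewrite !(add_lfunE, opp_lfunE, scale_lfunE, comp_lfunE, lfunE).
Qed.

Lemma half_derivation_mul p a :
  a \in P_ p -> half_derivation p (linfun (mul a)).
Proof. by move=> Pa q x y Px; rewrite !lfunE; apply: br_mul. Qed.

Lemma homogeneous_mul p a : a \in P_ p -> homogeneous p (linfun (mul a)).
Proof. by move=> Pa q x Px; rewrite lfunE; apply: (tps_mul_graded tpP). Qed.

(** The second condition is what makes commutation survive the passage from T to
    [ad_comm T x]; it is symmetric in T and U by [commuting_pair_sym]. *)
Definition commuting_pair p T q U :=
  (forall z, T (U z) = eps p q *: U (T z)) /\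
  forall r x z, x \in P_ r ->
    ad_comm T x (U z) = eps (p (+) r) q *: U (ad_comm T x z).

Lemma mul_comm p q a b z : a \in P_ p -> b \in P_ q ->
  mul a (mul b z) = eps p q *: mul b (mul a z).
Proof.
move=> Pa Pb; rewrite !(tps_mulA tpP) (tps_mulC tpP Pa Pb).
by rewrite linearZl_LR.
Qed.

(** Because L_a L_b = L_(ab) is a half superderivation, {(ab) x, z} can be
    expanded directly or by applying the law of L_a and then that of L_b; the
    comparison is the claim. *)
Lemma commuting_pair_mul p q a b : a \in P_ p -> b \in P_ q ->
  commuting_pair p (linfun (mul a)) q (linfun (mul b)).
Proof.
move=> Pa Pb; split=> [z|r x z Px].
  by rewrite !lfunE /= (mul_comm _ Pa Pb).
have ha := half_derivation_mul Pa; have hb := half_derivation_mul Pb.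
rewrite !(ad_comm_half _ ha Px) !lfunE /= !mulE.
rewrite (mul_comm (br x z) Pb Pa).
have := br_mul z (tps_mul_graded tpP Pa Pb) Px.
rewrite -!(tps_mulA tpP) (br_mul _ Pa (tps_mul_graded tpP Pb Px)).
rewrite !(br_mul _ Pb Px) (mul_comm z Pb Pa).
move=> J; apply: (lincomb2 (eps q r) J).
by case: p q r {Pa Pb Px ha hb J} => [] [] []; signs; vring.
Qed.

Lemma ad_commB T u v z : ad_comm T (u - v) z = ad_comm T u z - ad_comm T v z.
Proof. by rewrite !ad_commE !endE !brE; vring. Qed.

(** * Propagation of commutation along the orbit *)

Section CommutingPair.
Variables (p q : bool) (T U : 'End(P)).
Hypotheses (gT : homogeneous p T) (hT : half_derivation p T).
Hypothesis hU : half_derivation q U.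
Hypothesis TU : commuting_pair p T q U.

(** Modulo TU = +-UT, the supercommutators of U with [ad_x, T] and of T with
    [ad_x, U] are equal up to sign, by the Jacobi identity for operators. *)
Lemma commuting_pair_sym : commuting_pair q U p T.
Proof.
have [c d] := TU; split=> [z|r x z Px].
  by rewrite c; case: p q {c d} => [] []; signs; vring.
have := d r x z Px; rewrite !(ad_comm_half _ hT Px) !(ad_comm_half _ hU Px).
rewrite !endE !c => J; apply: (lincomb (eps (p (+) r) q * eps p r) J).
by case: p q r {Px d J c} => [] [] []; signs; vring.
Qed.

Lemma ad_comm_at_image r x z : x \in P_ r ->
  ad_comm U (T x) z = eps p q *: T (ad_comm U x z).
Proof.
have [c d] := TU => Px; have := d r x z Px.
rewrite !(ad_comm_half _ hT Px) (ad_comm_half _ hU (gT Px)).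
rewrite !(ad_comm_half _ hU Px) !(hT _ Px).
rewrite !endE !c => J; apply: (lincomb (- eps q (p (+) r)) J).
by case: p q r {Px d J c} => [] [] []; signs; vring.
Qed.

Lemma ad_comm_at_bracket a b u v z : u \in P_ a -> v \in P_ b ->
  ad_comm U (br u v) z = eps q a *: br u (ad_comm U v z) + ad_comm U u (br v z)
    - eps a b *: (eps q b *: br v (ad_comm U u z) + ad_comm U v (br u z)).
Proof.
move=> Pu Pv; rewrite !(ad_comm_half _ hU Pu) !(ad_comm_half _ hU Pv).
rewrite (ad_comm_half _ hU (tps_br_graded tpP Pu Pv)) !(br_Jacobi _ Pu Pv).
by case: q a b {Pu Pv} => [] [] []; signs; vring.
Qed.

(** The definition of [ad_comm], read as a rule that moves T out of a
    bracket. *)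
Lemma br_image s y v : y \in P_ s ->
  br y (T v) = eps p s *: (ad_comm T y v + T (br y v)).
Proof.
by move=> Py; rewrite (ad_comm_half _ hT Py); case: p s {Py} => [] [];
  signs; vring.
Qed.

End CommutingPair.

(** The subscript {x, y} is expanded in two ways: T {x, y} - {T x, y} is
    [ad_comm T x y], while [ad_comm U] is known at images of T and at brackets.
    All terms containing a bare T or ad cancel. *)
Lemma ad_comm_at_ad_comm p T q U r s x y w :
  homogeneous p T -> half_derivation p T ->
  homogeneous q U -> half_derivation q U -> commuting_pair p T q U ->
  x \in P_ r -> y \in P_ s ->
  ad_comm U (ad_comm T x y) w = eps q (p (+) r) *: ad_comm T x (ad_comm U y w)
    + eps p q * eps r s * eps q s *: ad_comm T y (ad_comm U x w)
    - eps (p (+) r) s *: ad_comm U y (ad_comm T x w).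
Proof.
move=> gT hT gU hU TU Px Py; have [_ UT] := commuting_pair_sym hT hU TU.
rewrite (ad_commE T x y) ad_commB.
rewrite (ad_comm_at_image gT hT hU TU _ (tps_br_graded tpP Px Py)).
rewrite (ad_comm_at_bracket hU _ (gT _ _ Px) Py).
rewrite (ad_comm_at_bracket hU _ Px Py).
rewrite !(ad_comm_at_image gT hT hU TU _ Px).
have E v : br (T x) v = T (br x v) - ad_comm T x v by rewrite ad_commE; vring.
rewrite !E !brE (br_image hT _ Py) !(endE, UT _ _ _ Py).
by case: p q r s {gT hT gU hU TU UT Px Py E} => [] [] [] []; signs; vring.
Qed.

(** In [ad_comm_at_ad_comm] the left-hand side and the two terms T_x U_y and
    T_y U_x are supersymmetric in x and y, hence so is the last term. *)
Lemma ad_comm_swap p T q U r s x y w :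
  homogeneous p T -> half_derivation p T ->
  homogeneous q U -> half_derivation q U -> commuting_pair p T q U ->
  x \in P_ r -> y \in P_ s ->
  ad_comm U y (ad_comm T x w)
    = eps p s * eps r s * eps p r *: ad_comm U x (ad_comm T y w).
Proof.
move=> gT hT gU hU TU Px Py.
have := ad_comm_at_ad_comm w gT hT gU hU TU Px Py.
have := ad_comm_at_ad_comm w gT hT gU hU TU Py Px.
rewrite (ad_comm_sym gT hT Py Px).
have E c u z : ad_comm U (c *: u) z = c *: ad_comm U u z.
  by rewrite !ad_commE; vring.
rewrite E => -> J; apply: (lincomb (eps (p (+) r) s) J).
by case: p q r s {gT hT gU hU TU Px Py J} => [] [] [] []; signs; vring.
Qed.

(** By [ad_comm_swap] both T_x U_y w and U_y T_x w are supersymmetric in all of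
    x, y, w, so every term of [ad_comm_at_ad_comm] is a multiple of one of the
    two, and the identity reads 2 T_x U_y w = +-2 U_y T_x w. *)
Lemma ad_comm_supercomm p T q U r s x y w :
  homogeneous p T -> half_derivation p T ->
  homogeneous q U -> half_derivation q U -> commuting_pair p T q U ->
  x \in P_ r -> y \in P_ s ->
  ad_comm T x (ad_comm U y w)
    = eps (p (+) r) (q (+) s) *: ad_comm U y (ad_comm T x w).
Proof.
move=> gT hT gU hU TU Px Py.
suff E : (ad_comm T x \o ad_comm U y)%VF =1
    (eps (p (+) r) (q (+) s) *: (ad_comm U y \o ad_comm T x))%VF.
  by have := E w; rewrite scale_lfunE !comp_lfunE.
apply: homogeneous_ext => t {}w Pw; rewrite scale_lfunE !comp_lfunE.
have := ad_comm_at_ad_comm w gT hT gU hU TU Px Py.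
rewrite (ad_comm_swap _ gU hU gT hT (commuting_pair_sym hT hU TU) Px Py).
rewrite (ad_comm_sym gU hU Pw (homogeneous_ad_comm gT Px Py)).
rewrite (ad_comm_swap _ gT hT gU hU TU Px Pw) (ad_comm_sym gT hT Py Pw) endE.
rewrite (ad_comm_swap _ gT hT gU hU TU Py Px).
move=> J; apply: (lincomb2 (- eps q (p (+) r)) J).
by case: p q r s t {gT hT gU hU TU Px Py Pw J} => [] [] [] [] []; signs; vring.
Qed.

Lemma commuting_pair_ad_comm p T q U r x :
  homogeneous p T -> half_derivation p T ->
  homogeneous q U -> half_derivation q U -> commuting_pair p T q U ->
  x \in P_ r -> commuting_pair (p (+) r) (ad_comm T x) q U.
Proof.
move=> gT hT gU hU TU Px; have [_ d] := TU; split=> [z|s y z Py].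
  exact: d.
have hTx := half_derivation_ad_comm gT hT Px.
rewrite !(ad_comm_half _ hTx Py) (d _ _ _ Px) !(brE, br_image hU _ Py) !endE.
rewrite (d _ _ _ Px) (ad_comm_supercomm _ gT hT gU hU TU Px Py).
by case: p q r s {gT hT gU hU TU d hTx Px Py} => [] [] [] []; signs; vring.
Qed.

(** The first argument is the parity of the operator. *)
Inductive ad_orbit : bool -> 'End(P) -> Prop :=
| ad_orbit_mul p a : a \in P_ p -> ad_orbit p (linfun (mul a))
| ad_orbit_ad_comm p T q y :
    ad_orbit p T -> y \in P_ q -> ad_orbit (p (+) q) (ad_comm T y).

Lemma ad_orbit_homogeneous p T : ad_orbit p T -> homogeneous p T.
Proof.
elim=> [{}p a Pa|{}p {}T q y _ IH Py]; first exact: homogeneous_mul.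
exact: homogeneous_ad_comm.
Qed.

Lemma ad_orbit_half_derivation p T : ad_orbit p T -> half_derivation p T.
Proof.
elim=> [{}p a Pa|{}p {}T q y gT IH Py]; first exact: half_derivation_mul.
by apply: half_derivation_ad_comm => //; apply: ad_orbit_homogeneous.
Qed.

Lemma ad_orbit_commuting_pair p T q U :
  ad_orbit p T -> ad_orbit q U -> commuting_pair p T q U.
Proof.
have [hom half] := (ad_orbit_homogeneous, ad_orbit_half_derivation).
elim=> [{}p a Pa|{}p {}T r x gT IH Px] gU; last first.
  by apply: commuting_pair_ad_comm; auto.
elim: gU => [{}q b Pb|{}q {}U r x gU IH Px]; first exact: commuting_pair_mul.
have gA := ad_orbit_mul Pa.
apply: commuting_pair_sym; auto; first by apply: half_derivation_ad_comm; auto.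
by apply: commuting_pair_ad_comm; auto; apply: commuting_pair_sym; auto.
Qed.
End Operators.

(** * Ideals of a simple algebra and nilpotency of the commutators *)

Section Simple.
Variables (F : closedFieldType) (P : vectType F) (P_ : bool -> {vspace P}).
Variables (mul br : {bilinear P -> P -> P}).
Hypothesis charF0 : [pchar F] =i pred0.
Hypothesis tpP : transposed_Poisson_superalgebra P_ mul br.
Hypothesis simpleP : simple_superalgebra P_ mul br.
Local Notation eps := (ssign F).
Local Notation ad_orbit := (ad_orbit P_ mul br).
Local Notation ad_comm := (ad_comm br).

Let natr_neq0 n : n.+1%:R != 0 :> F.
Proof. by move/pcharf0P: charF0 => ->. Qed.
Let two_neq0 : 2 != 0 :> F := natr_neq0 1.

Lemma homogeneous_unique x0 y0 x1 y1 : x0 \in P_ false -> y0 \in P_ false ->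
  x1 \in P_ true -> y1 \in P_ true -> x0 + x1 = y0 + y1 -> x0 = y0 /\ x1 = y1.
Proof.
move=> Px0 Py0 Px1 Py1 /eqP.
have [/directv_add_unique dP _] := tps_grading tpP.
by rewrite dP // => /eqP[].
Qed.

Lemma homogeneous_sum_eq0 x0 x1 : x0 \in P_ false -> x1 \in P_ true ->
  x0 + x1 = 0 -> x0 = 0 /\ x1 = 0.
Proof.
rewrite -{1}[0]addr0 => Px0 Px1.
exact: homogeneous_unique Px0 (mem0v _) Px1 (mem0v _).
Qed.

(** Closure is asked only for left operations by homogeneous elements;
    supercommutativity and linearity turn this into two-sided closure. *)
Lemma simple_pred (S : P -> Prop) : linear_pred S ->
  (forall x0 x1, x0 \in P_ false -> x1 \in P_ true -> S (x0 + x1) -> S x0) ->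
  (forall p a x, a \in P_ p -> S x -> S (mul a x)) ->
  (forall p a x, a \in P_ p -> S x -> S (br a x)) ->
  (forall x, S x -> x = 0) \/ (forall x, S x).
Proof.
move=> linS grS mulS brS; have [S0 Slin] := linS.
have SZ c x : S x -> S (c *: x).
  by move=> Sx; rewrite -[_ *: _]addr0; apply: Slin.
have SD x y : S x -> S y -> S (x + y).
  by move=> Sx Sy; rewrite -[x]scale1r; apply: Slin.
have SN x : S x -> S (- x) by rewrite -scaleN1r; apply: SZ.
have gr x : S x -> exists x0 x1,
    [/\ x0 \in P_ false, x1 \in P_ true, S x0, S x1 & x = x0 + x1].
  have [x0 Px0 [x1 Px1 ->]] := homogeneous_decomp tpP x => Sx.
  have Sx0 := grS _ _ Px0 Px1 Sx; exists x0, x1; split=> //.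
  by rewrite -[x1](addKr x0); apply: SD => //; apply: SN.
have [W WS] := vspace_of_pred linS.
have absorb (op : {bilinear P -> P -> P}) (e : bool -> bool -> F) :
    (forall p q x y, x \in P_ p -> y \in P_ q -> op x y = e p q *: op y x) ->
    (forall p a x, a \in P_ p -> S x -> S (op a x)) -> absorbs op W.
  move=> opC opS x y /WS /gr[x0 [x1 [Px0 Px1 Sx0 Sx1 ->]]]; apply/WS.
  have [y0 Py0 [y1 Py1 ->]] := homogeneous_decomp tpP y.
  rewrite linearDl /= !linearD /=; apply: (SD _ _ (SD _ _ _ _) (SD _ _ _ _)).
  - by rewrite (opC _ _ _ _ Px0 Py0); apply/SZ/(opS _ _ _ Py0).
  - by rewrite (opC _ _ _ _ Px0 Py1); apply/SZ/(opS _ _ _ Py1).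
  - by rewrite (opC _ _ _ _ Px1 Py0); apply/SZ/(opS _ _ _ Py0).
  - by rewrite (opC _ _ _ _ Px1 Py1); apply/SZ/(opS _ _ _ Py1).
have [|||W0|W1] := @simpleP W.
- apply/vspaceP=> x; apply/idP/memv_addP.
    move=> /WS /gr[x0 [x1 [Px0 Px1 Sx0 Sx1 ->]]].
    by exists x0; [|exists x1]; rewrite // memv_cap ?Px0 ?Px1 andbT; apply/WS.
  by move=> [x0 /memv_capP[Wx0 _] [x1 /memv_capP[Wx1 _] ->]]; apply: memvD.
- exact: absorb (tps_mulC tpP) mulS.
- apply: absorb (fun p q => - eps p q) _ brS => p q x y Px Py.
  by rewrite scaleNr; apply: (tps_br_anti tpP).
- by left=> x /WS; rewrite W0 memv0 => /eqP.
- by right=> x; apply/WS; rewrite W1 memvf.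
Qed.

Definition shift (T : 'End(P)) c : 'End(P) := T - c *: \1%VF.

Lemma shiftE T c x : shift T c x = T x - c *: x.
Proof. by rewrite add_lfunE opp_lfunE scale_lfunE id_lfunE. Qed.

Lemma ad_orbit_mulE p T q a x : ad_orbit p T -> a \in P_ q ->
  T (mul a x) = eps p q *: mul a (T x).
Proof.
move=> gT Pa.
have gA := ad_orbit_mul mul br Pa.
by have [/(_ x)] := ad_orbit_commuting_pair two_neq0 tpP gT gA; rewrite !lfunE.
Qed.

Lemma ad_orbit_supercomm p T q U x :
  ad_orbit p T -> ad_orbit q U -> T (U x) = eps p q *: U (T x).
Proof.
by move=> gT gU; have [] := ad_orbit_commuting_pair two_neq0 tpP gT gU.
Qed.

Lemma ad_orbit_br p T q y x : ad_orbit p T -> y \in P_ q ->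
  T (br y x) = eps p q *: br y (T x) - ad_comm T y x.
Proof.
move=> gT Py; rewrite (ad_comm_half _ (ad_orbit_half_derivation tpP gT) Py).
by rewrite opprB addrC subrK.
Qed.

Lemma iter_comm n (T U : 'End(P)) x : (forall x, T (U x) = U (T x)) ->
  iter n T (U x) = U (iter n T x).
Proof. by move=> TU; elim: n => //= n ->. Qed.

Lemma shift_comm T c q U x : ad_orbit false T -> ad_orbit q U ->
  shift T c (U x) = U (shift T c x).
Proof.
move=> gT gU; rewrite !shiftE [RHS]linearB [X in _ = _ - X]linearZ /=.
rewrite (ad_orbit_supercomm _ gT gU).
by rewrite /ssign /= expr0 scale1r.
Qed.

Lemma shift_br T c q y x : ad_orbit false T -> y \in P_ q ->
  shift T c (br y x) = br y (shift T c x) - ad_comm T y x.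
Proof.
move=> gT Py; rewrite !shiftE (ad_orbit_br _ gT Py).
rewrite linearBr [X in _ = _ - X - _]linearZ_LR /=.
by rewrite /ssign /= expr0 scale1r addrAC.
Qed.

(** The generalised eigenspace of T for c is an ideal: ad_y maps the kernel of
    (T - c)^n into that of (T - c)^(n+1), because (T - c) ad_y - ad_y (T - c) is
    -[ad_comm T y], which commutes with T. *)
Lemma ad_orbit_fitting T c : ad_orbit false T ->
  (forall x, T x = c *: x -> x = 0) \/ locally_nilpotent (shift T c).
Proof.
move=> gT.
have [||p a x Pa [n xn]|p y x Py [n]|S0|S1] :=
    @simple_pred (fun x => exists n, iter n (shift T c) x = 0); last by right.
- exact: locally_nilpotent_linear_pred.
- move=> x0 x1 Px0 Px1 [n]; rewrite -[x0]scale1r iter_linear !scale1r => e.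
  exists n; have gi q x : x \in P_ q -> iter n (shift T c) x \in P_ q.
    move=> Px; elim: n {e} => //= n IH; rewrite shiftE memvB ?memvZ //.
    exact: (ad_orbit_homogeneous tpP gT IH).
  by have [] := homogeneous_sum_eq0 (gi _ _ Px0) (gi _ _ Px1) e.
- have gA := ad_orbit_mul mul br Pa.
  exists n; have /= := iter_comm n x (fun z => shift_comm c z gT gA).
  by rewrite !lfunE /= xn => ->; rewrite linear0.
- move=> xn; exists n.+1; elim: n x xn => [x /= ->|n IH x].
    by rewrite !linear0.
  move=> xn; rewrite iterSr (shift_br _ _ gT Py).
  rewrite addrC -scaleN1r iter_linear (IH (shift T c x)) -?iterSr // addr0.
  rewrite iter_comm => [|z]; first by rewrite xn linear0 scaler0.
  exact: (shift_comm _ _ gT (ad_orbit_ad_comm gT Py)).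
- left=> x Tx; apply: S0; exists 1%N.
  by rewrite /= shiftE Tx subrr.
Qed.

(** Here u = [ad_comm T y] equals [ad_y, s] for the nilpotent s = T - c and
    commutes with s, so s^(n+1) = 0 yields (n+1) s^n u = 0.  This descent is
    where characteristic 0 is indispensable. *)
Lemma ad_comm_even_not_injective T (y w : P) :
  ad_orbit false T -> y \in P_ false -> w != 0 ->
  ~ (forall x, ad_comm T y x = 0 -> x = 0).
Proof.
move=> gT Py w0 inj.
have [c [v v0 Tv]] := exists_eigenvector T w0.
have [inj'|nil] := ad_orbit_fitting c gT.
  by move: v0; rewrite (inj' _ Tv) eqxx.
have [n nn] := nilpotent_of_locally_nilpotent nil.
have comm z : shift T c (ad_comm T y z) = ad_comm T y (shift T c z).
  exact: (shift_comm _ _ gT (ad_orbit_ad_comm gT Py)).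
have iter_br k z : iter k.+1 (shift T c) (br y z)
    = br y (iter k.+1 (shift T c) z)
      - k.+1%:R *: ad_comm T y (iter k (shift T c) z).
  elim: k z => [|k IH] z; first by rewrite /= (shift_br _ _ gT Py) scale1r.
  rewrite iterS IH linearB [X in _ - X = _]linearZ /= (shift_br _ _ gT Py) comm.
  by rewrite -addrA -opprD [k.+2%:R]mulrS scalerDl scale1r.
(* An injective u lowers the exponent n one step at a time, down to s^0 = 0. *)
elim: n nn => [|n IH] nn; first by move: w0; rewrite [w](nn w) eqxx.
apply: IH => z; apply: inj.
have /eqP := iter_br n z; rewrite !nn linear0 sub0r eq_sym oppr_eq0.
by rewrite scaler_eq0 (negbTE (natr_neq0 n)) => /eqP.
Qed.

Lemma ad_orbit_odd_square p T x : ad_orbit p T -> p -> T (T x) = 0.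
Proof.
move=> gT pT; have /eqP := ad_orbit_supercomm x gT gT.
rewrite pT /ssign /= expr1 scaleN1r.
by rewrite -addr_eq0 -mulr2n -scaler_nat scaler_eq0 (negbTE two_neq0) => /eqP.
Qed.

Lemma shift0 T x : shift T 0 x = T x.
Proof. by rewrite shiftE scale0r subr0. Qed.

Lemma ad_comm_locally_nilpotent p T q y : ad_orbit p T -> y \in P_ q ->
  locally_nilpotent (ad_comm T y).
Proof.
move=> gT Py; have gu := ad_orbit_ad_comm gT Py.
case pq: (p (+) q) gu => gu.
  by move=> x; exists 2; apply: (ad_orbit_odd_square _ gu).
suff ninj : (forall x, ad_comm T y x = 0 -> x = 0) -> forall x : P, x = 0.
  have [inj|nil] := ad_orbit_fitting 0 gu; last first.
    by move=> z; have [n] := nil z; exists n; rewrite -(eq_iter (shift0 _)).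
  move=> z; exists 0%N; apply: ninj => x ux; apply: inj.
  by rewrite ux scale0r.
case: p q pq gT Py {gu} => [] [] // _ gT Py inj x.
  (* For y and T odd, supersymmetry makes ad_comm T y y its own opposite. *)
  have y0 : y = 0.
    apply: inj; have /eqP := ad_comm_sym tpP (ad_orbit_homogeneous tpP gT)
      (ad_orbit_half_derivation tpP gT) Py Py.
    rewrite /ssign /= expr1 scaleN1r -addr_eq0 -mulr2n -scaler_nat.
    by rewrite scaler_eq0 (negbTE two_neq0) => /eqP.
  by apply: inj; rewrite ad_commE y0 !linear0 !linear0l linear0 subr0.
apply/eqP/negPn/negP => x0; exact: (ad_comm_even_not_injective gT Py x0).
Qed.

(** The common kernel of all [ad_comm T y] is a graded ideal, as T_y ad_z is
    +-ad_z T_y +- (T_y)_z; it is not 0 because these operators are nilpotent and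
    supercommute. *)
Lemma ad_comm_eq0 p T q y x : ad_orbit p T -> y \in P_ q -> ad_comm T y x = 0.
Proof.
move=> gT Py.
pose S z := forall p T q y, ad_orbit p T -> y \in P_ q -> ad_comm T y z = 0.
suff: S x by move=> Sx; apply: Sx gT Py.
have [||r a z Pa Sz|r a z Pa Sz|S0|//] := @simple_pred S.
- split=> [|c u v Su Sv] p' T' q' y' gT' Py'; first by rewrite linear0.
  by rewrite linearP /= (Su _ _ _ _ gT' Py') (Sv _ _ _ _ gT' Py') scaler0 addr0.
- move=> x0 x1 Px0 Px1 Sx p' T' q' y' gT' Py'.
  have := Sx _ _ _ _ gT' Py'; rewrite linearD /= => e.
  have := ad_orbit_homogeneous tpP (ad_orbit_ad_comm gT' Py').
  move: e; case: (_ (+) _) => + gu; have [/= d0 d1] := (gu _ _ Px0, gu _ _ Px1).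
    rewrite addrC.
    by move=> /(homogeneous_sum_eq0 d1 d0)[].
  by move=> /(homogeneous_sum_eq0 d0 d1)[].
- move=> p' T' q' y' gT' Py'.
  rewrite (ad_orbit_mulE _ (ad_orbit_ad_comm gT' Py') Pa).
  by rewrite (Sz _ _ _ _ gT' Py') linear0 scaler0.
- move=> p' T' q' y' gT' Py'; have gu := ad_orbit_ad_comm gT' Py'.
  rewrite (ad_orbit_br _ gu Pa) (Sz _ _ _ _ gT' Py') (Sz _ _ _ _ gu Pa).
  by rewrite linear0 scaler0 subr0.
- have [->|x0] := eqVneq x 0; first by move=> *; rewrite linear0.
  pose D u := exists p T q y, [/\ ad_orbit p T, y \in P_ q & u = ad_comm T y].
  have [u [p' [T' [q' [y' [gT' Py' ->]]]]]||||v v0 Sv] :=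
    @common_kernel _ _ D fullv.
  + exact: ad_comm_locally_nilpotent gT' Py'.
  + move=> u1 u2 [p1 [T1 [q1 [y1 [gT1 Py1 ->]]]]].
    move=> [p2 [T2 [q2 [y2 [gT2 Py2 ->]]]]].
    have g1 := ad_orbit_ad_comm gT1 Py1; have g2 := ad_orbit_ad_comm gT2 Py2.
    by eexists => z; apply: (ad_orbit_supercomm _ g1 g2).
  + by apply: contraNneq x0 => f0; rewrite -memv0 -f0 memvf.
  + by move=> *; apply: memvf.
  + suff v00 : v = 0 by rewrite v00 eqxx in v0.
    by apply: S0 => p' T' q' y' gT' Py'; apply: Sv; exists p', T', q', y'.
Qed.

(** * Multiplications are scalars *)

Lemma mul_br p a q y x : a \in P_ p -> y \in P_ q ->
  mul a (br y x) = eps p q *: br y (mul a x).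
Proof.
move=> Pa Py; have gA := ad_orbit_mul mul br Pa.
by have := ad_orbit_br x gA Py; rewrite (ad_comm_eq0 _ gA Py) subr0 !lfunE.
Qed.

(** For a odd, a is killed by L_a, so the ideal ker L_a is everything. *)
Lemma mul_odd a x : a \in P_ true -> mul a x = 0.
Proof.
move=> Pa; have [->|a0] := eqVneq a 0; first by rewrite linear0l.
have [||r b z Pb az|r b z Pb az|S0|S1] := @simple_pred (fun z => mul a z = 0).
- by split=> [|c u v au av]; rewrite ?linear0 // linearP /= au av scaler0 addr0.
- move=> x0 x1 Px0 Px1; rewrite linearDr addrC /=.
  have grA := tps_mul_graded tpP Pa.
  by move=> /(homogeneous_sum_eq0 (grA _ _ Px1) (grA _ _ Px0))[].
- by rewrite (mul_comm tpP z Pa Pb) az linear0 scaler0.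
- by rewrite (mul_br _ Pa Pb) az linear0 scaler0.
- suff aa : mul a a = 0 by move: a0; rewrite (S0 _ aa) eqxx.
  have /eqP := tps_mulC tpP Pa Pa.
  rewrite /ssign /= expr1 scaleN1r -addr_eq0 -mulr2n -scaler_nat.
  by rewrite scaler_eq0 (negbTE two_neq0) => /eqP.
- exact: S1.
Qed.

(** Eigenspaces of L_a are ideals. *)
Lemma mul_even a : a \in P_ false -> exists c, forall x, mul a x = c *: x.
Proof.
move=> Pa; have [->|a0] := eqVneq a 0.
  by exists 0 => x; rewrite linear0l scale0r.
have [c [v v0]] := exists_eigenvector (linfun (mul a)) a0.
rewrite lfunE => /= av.
exists c.
have [||r b z Pb az|r b z Pb az|S0|S1] :=
  @simple_pred (fun z => mul a z = c *: z) => //.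
- split=> [|d u w au aw]; rewrite ?linear0 ?scaler0 // linearP /= au aw.
  by rewrite scalerDr !scalerA mulrC.
- move=> x0 x1 Px0 Px1; rewrite linearDr scalerDr /= => e.
  by have [] := homogeneous_unique (tps_mul_graded tpP Pa Px0) (memvZ _ Px0)
    (tps_mul_graded tpP Pa Px1) (memvZ _ Px1) e.
- by rewrite (mul_comm tpP z Pa Pb) az /ssign /= expr0 scale1r linearZ_LR.
- by rewrite (mul_br _ Pa Pb) az /ssign /= expr0 scale1r linearZ_LR.
- by move: v0; rewrite (S0 _ av) eqxx.
Qed.

Lemma mul_or_br_eq0 : (forall x y, mul x y = 0) \/ (forall x y, br x y = 0).
Proof.
have [[a Pa [z az]]|no] :=
  classic (exists2 a, a \in P_ false & exists y, mul a y <> 0); last first.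
  left=> x y; have [x0 Px0 [x1 Px1 ->]] := homogeneous_decomp tpP x.
  rewrite linearDl (mul_odd _ Px1) addr0; apply: NNPP => xy.
  by apply: no; exists x0 => //; exists y.
have [c cE] := mul_even Pa; have c0 : c != 0.
  by apply: contra_notN az => /eqP c0; rewrite cE c0 scale0r.
have line x : exists d, x = d *: a.
  have [x0 Px0 [x1 Px1 ->]] := homogeneous_decomp tpP x.
  have /eqP : c *: x1 = 0.
    by rewrite -cE (tps_mulC tpP Pa Px1) mul_odd // scaler0.
  rewrite scaler_eq0 (negbTE c0) => /eqP ->.
  have [d dE] := mul_even Px0; exists (c^-1 * d).
  rewrite addr0 -scalerA -dE (tps_mulC tpP Px0 Pa) /ssign /= expr0 scale1r.
  by rewrite cE scalerA mulVf // scale1r.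
have /eqP aa : br a a = 0.
  have /eqP := tps_br_anti tpP Pa Pa; rewrite /ssign /= expr0 scale1r.
  by rewrite -addr_eq0 -mulr2n -scaler_nat scaler_eq0 (negbTE two_neq0) => /eqP.
right=> x y; have [[d ->] [e ->]] := (line x, line y).
by rewrite linearZl_LR linearZ_LR /= (eqP aa) !scaler0.
Qed.

End Simple.

Theorem theorem21 (F : closedFieldType) (charF0 : [pchar F] =i pred0)
    (P : vectType F) (P_ : bool -> {vspace P})
    (mul br : {bilinear P -> P -> P}) :
  transposed_Poisson_superalgebra P_ mul br ->
  simple_superalgebra P_ mul br ->
  (forall x y, mul x y = 0) \/ (forall x y, br x y = 0).
Proof. by move=> tpP simpleP; apply: mul_or_br_eq0 simpleP. Qed.
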